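(* Let $p\geq1$ and let $l,y,l',y'\in D(\mathbb{R}^+,\mathbb{R}^d)$ be such that $l_0\leq y_0$ and $l'_0\leq y'_0$. Let $(x,k)=SP_l(y)$ and $(x',k')=SP_{l'}(y')$. Then for any $T\in\mathbb{R}^+$, \[ V_p(x-x')_T\leq (d+1)V_p(y-y')_T+d|y_0-y'_0|+dV_p(l-l')_T+d|l_0-l'_0| \] and \[ V_p(k-k')_T\leq dV_p(y-y')_T+d|y_0-y'_0|+dV_p(l-l')_T+d|l_0-l'_0|. \]
   Context: $\mathbb{R}^+=[0,\infty)$; $D(\mathbb{R}^+,\mathbb{R}^d)$ is the space of càdlàg functions $\mathbb{R}^+\to\mathbb{R}^d$. For such $x$, $v_p(x)_{[a,b]}=\sup\sum_{i=1}^n|x_{t_i}-x_{t_{i-1}}|^p$ over subdivisions $a=t_0<\dots<t_n=b$ ($|\cdot|$ Euclidean norm), $V_p(x)_{[a,b]}=(v_p(x)_{[a,b]})^{1/p}$ and $V_p(x)_T=V_p(x)_{[0,T]}$. For vectors, $u\leq v$ means $u^i\leq v^i$ for all components; for functions, $x\leq x'$ means $x_t\leq x'_t$ for all $t$. Skorokhod problem: given $y,l\in D(\mathbb{R}^+,\mathbb{R}^d)$ with $l_0\leq y_0$, a pair $(x,k)$ of elements of $D(\mathbb{R}^+,\mathbb{R}^d)$ is a solution of the Skorokhod problem associated with $y$ and lower barrier $l$, written $(x,k)=SP_l(y)$, if (i) $x_t=y_t+k_t\geq l_t$ for all $t\in\mathbb{R}^+$; (ii) $k_0=0$, each component $k^i$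 is nondecreasing and $\int_0^t(x^i_s-l^i_s)\,dk^i_s=0$ for all $t$ and $i=1,\dots,d$. *)

(* Defs.v *)
From HB Require Import structures.
From mathcomp Require Import all_boot all_order all_algebra.
From mathcomp Require Import all_classical all_reals all_analysis.
Set Implicit Arguments. Unset Strict Implicit. Unset Printing Implicit Defensive.
Import Order.TTheory GRing.Theory Num.Theory.
Import numFieldNormedType.Exports.
Local Open Scope classical_set_scope.
Local Open Scope ring_scope.

Definition eucl {R : realType} {d : nat} (v : 'rV[R]_d) : R :=
  Num.sqrt (\sum_(i < d) (v ord0 i) ^+ 2).

Definition vle {R : realType} {d : nat} (u v : 'rV[R]_d) : Prop :=
  forall i : 'I_d, u ord0 i <= v ord0 i.

Definition cadlag {R : realType} {d : nat} (x : R -> 'rV[R]_d) : Prop :=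
  (forall t : R, 0 <= t -> x @ at_right t --> x t) /\
  (forall t : R, 0 < t -> cvg (x @ at_left t)).

Definition subdivision {R : realType} (a b : R) (n : nat) (t : nat -> R) : Prop :=
  t 0%N = a /\ t n = b /\ (forall i : nat, (i < n)%N -> t i < t i.+1).

Definition pvar {R : realType} {d : nat} (p : R) (x : R -> 'rV[R]_d) (a b : R)
  : \bar R :=
  ereal_sup [set r : \bar R | exists (n : nat) (t : nat -> R),
      subdivision a b n t /\
      r = ((\sum_(i < n) (eucl (x (t i.+1) - x (t i))) `^ p)%:E)%E].

Definition Vp {R : realType} {d : nat} (p : R) (x : R -> 'rV[R]_d) (T : R)
  : \bar R :=
  poweR (pvar p x 0 T) (p^-1).

(* (x,k) = SP_l(y): solution of the Skorokhod problem with lower barrier l.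
   The Stieltjes integral int_0^t (x^i_s - l^i_s) dk^i_s is taken against the
   Lebesgue-Stieltjes measure of the nondecreasing right-continuous function
   equal to k^i on [0,oo) and to 0 on (-oo,0) (so that k^i_0 = 0 carries no
   mass at 0). *)
Definition SP {R : realType} {d : nat} (l y x k : R -> 'rV[R]_d) : Prop :=
  cadlag x /\ cadlag k /\
  (forall t : R, 0 <= t -> x t = y t + k t /\ vle (l t) (x t)) /\
  k 0 = 0 /\
  (forall i : 'I_d, forall s t : R, 0 <= s -> s <= t -> k s ord0 i <= k t ord0 i) /\
  (forall i : 'I_d, exists F : cumulative R R,
      (forall s : R, 0 <= s -> F s = k s ord0 i) /\
      (forall s : R, s < 0 -> F s = 0) /\
      (forall t : R, 0 <= t ->
         (\int[lebesgue_stieltjes_measure F]_(s in `[0%R, t]%classic)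
             ((x s ord0 i - l s ord0 i)%:E))%E = 0%E)).

(* Main.v *)
(** In each coordinate, [k] is the running supremum of [l - y], reset to [0] at
    time [0], and likewise for [k'].  Put [f = k - k'] and
    [g = (l - y) - (l' - y')], with [g 0 = 0].  If [f] increases from [s] to [t],
    then so does [k], so the barrier is hit at some [u] in [(s, t]] with [k u]
    close to [k t]; since [k' t >= k' u >= l' u - y' u], this gives
    [f t <= g u + e].  Symmetrically [f t >= g u - e] for some such [u] if [f]
    decreases.  As [p >= 1], merging consecutive increments of [f] of the same
    sign only increases the sum of their [p]-th powers; once the increments
    alternate, the points [u] attached to consecutive local extrema are
    increasing and the increments of [g] between them dominate those of [f], up
    to [2 e].  Hence the [p]-variation of [f] is at most that of [g], and
    Minkowski's inequality yields the bounds. *)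

Require Import Defs.
From HB Require Import structures.
From mathcomp Require Import all_boot all_order all_algebra.
From mathcomp Require Import all_classical all_reals all_analysis.
From mathcomp Require Import measurable_realfun ring lra.
Import Order.TTheory GRing.Theory Num.Theory.
Import numFieldNormedType.Exports.
Local Open Scope ring_scope.
Local Open Scope classical_set_scope.

(** * Measurability of right-continuous functions *)

(** Followed by the injection of [nat] into [R], the map is nondecreasing, hence measurable; the
    preimage of [Y] is then that of a countable set of reals. *)
Lemma measurable_truncn_scale {R : realType} (c : R) : 0 <= c ->
  measurable_fun setT (fun u : R => Num.truncn (c * u)).
Proof.
move=> c0 _ Y _; rewrite setTI.
have -> : (fun u : R => Num.truncn (c * u)) @^-1` Y =
    (fun u : R => (Num.truncn (c * u))%:R : R) @^-1` ((fun m : nat => m%:R) @` Y).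
  apply/seteqP; split => u /=; first by move=> Yu; exists (Num.truncn (c * u)).
  by move=> [m Ym /eqP]; rewrite eqr_nat => /eqP <-.
rewrite -[X in measurable X]setTI.
apply: (@nondecreasing_measurable R setT
  (fun u : R => (Num.truncn (c * u))%:R)) => //.
  by move=> a b ab; rewrite ler_nat le_truncn// ler_wpM2l.
apply: countable_measurable; first by move=> t; exact: measurable_set1.
apply: card_le_trans (card_image_le _ _) _; exact: countableP.
Qed.

Lemma right_continuous_measurable {R : realType} (h : R -> R) (D : set R) :
  measurable D -> D `<=` `[0, +oo[ ->
  (forall u, 0 <= u -> h @ at_right u --> h u) -> measurable_fun D h.
Proof.
move=> mD D0 hr.
(* [r n u] is the first multiple of [1/(n+1)] strictly to the right of [u]. Since [h \o r n] factors
   through [nat], it is measurable whatever [h] is, and it tends pointwise to [h] by right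
   continuity. *)
pose r (n : nat) (u : R) : R := (Num.truncn (n.+1%:R * u)).+1%:R / n.+1%:R.
apply: (@measurable_fun_cvg _ _ _ _ (fun n => h \o r n)).
  move=> n; apply: measurable_funS measurableT _ _ => //.
  rewrite (_ : h \o r n = (fun m : nat => h (m.+1%:R / n.+1%:R)) \o
     (fun u : R => Num.truncn (n.+1%:R * u)))//.
  apply: measurableT_comp; first exact: (fun _ _ _ => I).
  exact: measurable_truncn_scale.
move=> u /D0 /=; rewrite in_itv/= andbT => u0.
apply: (cvg_at_rightP h u (h u)).1; first exact: hr.
have ur n : u < r n u by rewrite /r ltr_pdivlMr// mulrC truncnS_gt.
split => //.
have ru n : r n u <= u + n.+1%:R^-1.
  rewrite /r -(@ler_pM2r _ n.+1%:R)// divfK// mulrDl mulVf// -natr1 lerD2r mulrC.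
  by rewrite truncn_le mulr_ge0.
apply/cvgrPdist_lt => _/posnumP[e]; near=> n.
rewrite distrC ger0_norm ?subr_ge0 ?(ltW (ur n))//.
rewrite ltrBlDl (le_lt_trans (ru n))// ltrD2l.
by near: n; exact: near_infty_natSinv_lt.
Unshelve. all: by end_near. Qed.

(** * Lebesgue-Stieltjes measures and contact with the barrier *)

Lemma lebesgue_stieltjes_itvoc {R : realType} (F : cumulative R R) (a b : R) :
  a <= b -> lebesgue_stieltjes_measure F `]a, b] = (F b - F a)%:E.
Proof.
move=> ab; rewrite /lebesgue_stieltjes_measure/= /measure_extension/=.
rewrite measurable_mu_extE/=; first by rewrite wlength_itv_bnd.
exact: is_ocitv.
Qed.

(** The closed interval is the decreasing intersection of the []r - 1/(n+1), t]], each of mass at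
    least [F t - c]; continuity from above concludes. A jump of [F] at [r] is thereby counted. *)
Lemma lebesgue_stieltjes_itvcc_ge {R : realType} (F : cumulative R R) (c r t : R) :
  r <= t -> (forall u, u < r -> F u <= c) ->
  ((F t - c)%:E <= lebesgue_stieltjes_measure F `[r, t])%E.
Proof.
move=> rt Fc; set mu := lebesgue_stieltjes_measure F.
pose E n : set R := `]r - n.+1%:R^-1, t].
have En n : mu (E n) = (F t - F (r - n.+1%:R^-1))%:E.
  rewrite /mu lebesgue_stieltjes_itvoc// (le_trans _ rt)// lerBlDr lerDl.
  by rewrite invr_ge0.
have EE : \bigcap_n E n = `[r, t].
  apply/seteqP; split => u /=; rewrite in_itv/=.
    move=> Eu; have := Eu 0%N I; rewrite /E/= in_itv/= => /andP[_ ->].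
    rewrite andbT leNgt; apply/negP => ur.
    have ru : 0 < r - u by rewrite subr_gt0.
    have [n _ /(_ n (leqnn n))/= rn] := near_infty_natSinv_lt (PosNum ru).
    have := Eu n I; rewrite /E/= in_itv/= => /andP[+ _].
    by rewrite ltrBlDr -ltrBlDl => /(lt_trans rn); rewrite ltxx.
  move=> /andP[ru ut] n _; rewrite /E/= in_itv/= ut andbT.
  by rewrite (lt_le_trans _ ru)// ltrBlDr ltrDl.
have E0 : (mu (E 0%N) < +oo)%E by rewrite En ltry.
have cE : mu \o E @ \oo --> mu (\bigcap_n E n).
  apply: nonincreasing_cvg_mu.
  - exact: E0.
  - by move=> n; exact: measurable_itv.
  - by rewrite EE; exact: measurable_itv.
  - move=> m n mn; apply/subsetPset => u /=; rewrite /E/= !in_itv/= => /andP[+ ->].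
    rewrite andbT; apply: le_lt_trans; rewrite lerD2l lerN2 lef_pV2 ?posrE//.
    by rewrite ler_nat.
rewrite -EE -(cvg_lim _ cE)//; apply: lime_ge.
  by apply/cvg_ex; eexists; exact: cE.
apply: nearW => n; rewrite /= En lee_fin lerD2l lerN2 Fc//.
by rewrite ltrBlDr ltrDl.
Qed.

(** Let [r] be the first time [F] reaches a level [c] close to [F t]. Then [[r, t]] has positive
    mass, so [h], which vanishes almost everywhere on [[0, t]], has a zero there. *)
Lemma stieltjes_integral0_touch {R : realType} (F : cumulative R R) (h : R -> R)
    (s t e : R) :
  0 <= s -> s <= t -> (forall u, 0 <= u -> h @ at_right u --> h u) ->
  (forall u, 0 <= u -> 0 <= h u) ->
  (\int[lebesgue_stieltjes_measure F]_(u in `[0%R, t]) (h u)%:E)%E = 0%E ->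
  F s < F t -> 0 < e ->
  exists u, [/\ s < u, u <= t, h u = 0 & F t - e <= F u].
Proof.
move=> s0 st hr h0 ih Fst e0.
have ndF := cumulative_is_nondecreasing F.
(* The midpoint keeps [c] strictly above [F s] even when [e] is large. *)
pose c := Num.max (F t - e) ((F s + F t) / 2).
have sc : F s < c by rewrite /c lt_max; apply/orP; right; lra.
have ct : c < F t by rewrite /c gt_max; apply/andP; split; lra.
have ec : F t - e <= c by rewrite /c le_max lexx.
pose S : set R := [set u | c <= F u].
have St : S t by exact: ltW.
have Ss : lbound S s.
  move=> u /= cu; rewrite leNgt; apply/negP => /ltW /ndF /(le_trans cu).
  by rewrite leNgt sc.
have hS : has_inf S by split; [exists t|exists s].
pose r := inf S.
have rt : r <= t by apply: ge_inf => //; exists s.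
have ltr u : u < r -> F u <= c.
  move=> ur; rewrite leNgt; apply/negP => /ltW cu.
  by have := ge_inf hS.2 cu; rewrite leNgt ur.
have cr : c <= F r.
  (* Every [v > r] exceeds some point of [S], so [c <= F v]; right continuity passes this to [r]. *)
  apply: (cvgr_to_ge (cumulative_is_right_continuous F r)).
  near=> v.
  have rv : r < v by near: v; exact: nbhs_right_gt.
  have /(inf_adherent)/(_ hS)[w Sw] : 0 < v - r by rewrite subr_gt0.
  by rewrite subrKC => /ltW/ndF; exact: le_trans.
have sr : s < r.
  by rewrite ltNge; apply/negP => /ndF /(le_trans cr); rewrite leNgt sc.
apply: contrapT => nex.
have hn u : r <= u -> u <= t -> h u <> 0.
  move=> ru ut hu; apply: nex; exists u; split => //; first exact: lt_le_trans ru.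
  by rewrite (le_trans ec)// (le_trans cr)// ndF.
have mh : measurable_fun (`[0, t] : set R) (EFin \o h).
  apply/measurable_EFinP; apply: right_continuous_measurable => //.
  by move=> u /=; rewrite !in_itv/= => /andP[->].
have m0t : measurable (`[0, t]%classic : set (measurableTypeR R)).
  exact: measurable_itv.
have := (ae_eq_integral_abs (lebesgue_stieltjes_measure F) m0t mh).1.
case.
  rewrite -[RHS]ih; apply: eq_integral => u; rewrite inE/= in_itv/= => /andP[u0 _].
  by rewrite ger0_norm ?h0.
(* [N] is a null set containing every point of [[0, t]] where [h] is nonzero, hence all of [[r, t]]
   if there is no contact. *)
move=> N [mN N0 subN].
have := lebesgue_stieltjes_itvcc_ge F c r t rt ltr.
rewrite leNgt => /negP; apply.
apply: (@le_lt_trans _ _ (lebesgue_stieltjes_measure F N)).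
  have mrt : measurable (`[r, t]%classic : set (measurableTypeR R)).
    exact: measurable_itv.
  apply: le_measure; rewrite ?inE//.
  move=> u /=; rewrite in_itv/= => /andP[ru ut]; apply: subN => /= hu.
  apply: (hn u) => //; apply/EFin_inj/hu; rewrite in_itv/= ut andbT.
  by rewrite (le_trans _ ru)// (le_trans s0)// ltW.
by rewrite N0 lte_fin subr_gt0.
Unshelve. all: by end_near. Qed.

(** * Finite [l^p] norms and Minkowski's inequality *)

Section lp_norm.
Context {R : realType}.
Implicit Types (p : R) (a b : nat -> R).

(** The usual [l^p] norm when the entries are nonnegative; no absolute value is taken. *)
Definition lp p n a : R := (\sum_(i < n) a i `^ p) `^ p^-1.

Lemma lp_ge0 p n a : 0 <= lp p n a.
Proof. exact: powR_ge0. Qed.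

Lemma sum_powR_ge0 p n a : 0 <= \sum_(i < n) a i `^ p.
Proof. by apply: sumr_ge0 => i _; exact: powR_ge0. Qed.

Lemma lp_powR p n a : 1 <= p -> lp p n a `^ p = \sum_(i < n) a i `^ p.
Proof.
move=> p1; rewrite /lp -powRrM mulVf ?powRr1 ?sum_powR_ge0//.
by rewrite gt_eqF// (lt_le_trans _ p1).
Qed.

Lemma lp_leP p n a (C : R) : 1 <= p -> 0 <= C ->
  lp p n a <= C <-> \sum_(i < n) a i `^ p <= C `^ p.
Proof.
move=> p1 C0; have p0 : 0 <= p by exact: le_trans p1.
split=> [aC|].
  by rewrite -lp_powR// ge0_ler_powR// nnegrE// lp_ge0.
have {2}-> : C = (C `^ p) `^ p^-1.
  by rewrite -powRrM mulfV ?powRr1// gt_eqF// (lt_le_trans _ p1).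
by move=> aC; rewrite ge0_ler_powR// ?invr_ge0// nnegrE ?sum_powR_ge0 ?powR_ge0.
Qed.

Lemma le_lp p n a b : 1 <= p ->
  (forall i, (i < n)%N -> 0 <= a i <= b i) -> lp p n a <= lp p n b.
Proof.
move=> p1 ab; apply/lp_leP; rewrite ?lp_ge0// lp_powR// ler_sum// => i _.
have /andP[a0 aibi] := ab i (ltn_ord i).
by rewrite ge0_ler_powR ?nnegrE ?(le_trans _ p1)// (le_trans a0).
Qed.

(** Write [x^p = x * x^(p-1)] and bound [x^(p-1)] by [(x+y)^(p-1)], likewise for [y]. This is what
    allows increments of the same sign to be merged. *)
Lemma powR_superadditive p (x y : R) : 1 <= p -> 0 <= x -> 0 <= y ->
  x `^ p + y `^ p <= (x + y) `^ p.
Proof.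
move=> p1 x0 y0; have p0 : 0 < p by exact: lt_le_trans p1.
rewrite -(mulr_powRB1 x0 p0) -(mulr_powRB1 y0 p0).
rewrite -(mulr_powRB1 (addr_ge0 x0 y0) p0) mulrDl.
have pB : 0 <= p - 1 by rewrite subr_ge0.
by apply: lerD; apply: ler_wpM2l => //; apply: ge0_ler_powR => //;
  rewrite ?nnegrE ?addr_ge0// ?lerDl ?lerDr.
Qed.

Lemma lp_le_sum p n a : 1 <= p -> (forall i, (i < n)%N -> 0 <= a i) ->
  lp p n a <= \sum_(i < n) a i.
Proof.
move=> p1; have p0 : 0 < p by exact: lt_le_trans p1.
move=> a0; apply/lp_leP => //; first by apply: sumr_ge0 => i _; exact: a0.
elim: n a0 => [|n IH] a0; first by rewrite !big_ord0 powR0// gt_eqF.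
rewrite !big_ord_recr/= (le_trans _ (powR_superadditive _ _ _ p1 _ _)) ?a0//.
  by rewrite lerD2r IH// => i /ltnW; exact: a0.
by apply: sumr_ge0 => i _; apply: a0; rewrite ltnS ltnW.
Qed.

(** Convexity of the [p]-th power at [a i / A] and [b i / B], with weights [A/(A+B)] and [B/(A+B)].
    Positive bounds [A], [B] replace the norms, which may be zero. *)
Lemma lp_minkowski_gt0 p n a b (A B : R) : 1 <= p -> 0 < A -> 0 < B ->
  (forall i, (i < n)%N -> 0 <= a i) -> (forall i, (i < n)%N -> 0 <= b i) ->
  lp p n a <= A -> lp p n b <= B -> lp p n (fun i => a i + b i) <= A + B.
Proof.
move=> p1 A0 B0 a0 b0 /(lp_leP _ _ _ _ p1 (ltW A0)) aA.
move=> /(lp_leP _ _ _ _ p1 (ltW B0)) bB.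
have AB0 : 0 < A + B by exact: addr_gt0.
apply/lp_leP => //; first exact: ltW.
pose w := A / (A + B).
have w0 : 0 <= w by rewrite divr_ge0 ?ltW.
have w1 : w <= 1 by rewrite ler_pdivrMr// mul1r lerDl ltW.
have w1E : 1 - w = B / (A + B) by rewrite /w; field; rewrite gt_eqF.
have conv (i : 'I_n) : (a i + b i) `^ p <=
    (A + B) `^ p * (w * (a i `^ p / A `^ p) + (1 - w) * (b i `^ p / B `^ p)).
  have ai := a0 i (ltn_ord i); have bi := b0 i (ltn_ord i).
  have -> : a i + b i = (A + B) * (w * (a i / A) + (1 - w) * (b i / B)).
    by rewrite w1E /w; field; rewrite !gt_eqF.
  rewrite powRM ?(ltW AB0)//; last first.
    by rewrite addr_ge0// mulr_ge0 ?subr_ge0// divr_ge0// ltW.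
  apply: ler_wpM2l; first exact: powR_ge0.
  have powV (u v : R) : 0 <= u -> 0 < v -> (u / v) `^ p = u `^ p / v `^ p.
    move=> u0 v0; have vp : v `^ p != 0 by rewrite gt_eqF// powR_gt0.
    by apply: (mulIf vp); rewrite divfK// -powRM ?divr_ge0 ?(ltW v0)// divfK// gt_eqF.
  have aA0 : a i / A \in (`[0, +oo[%classic : set R).
    by rewrite inE/= in_itv/= andbT divr_ge0// ltW.
  have bB0 : b i / B \in (`[0, +oo[%classic : set R).
    by rewrite inE/= in_itv/= andbT divr_ge0// ltW.
  have := convex_powR p1 (Itv01 w0 w1) aA0 bB0.
  by rewrite !convRE/= !powV.
apply: (le_trans (ler_sum _ (fun i _ => conv i))).
rewrite -mulr_sumr ler_piMr ?powR_ge0// big_split/= -!mulr_sumr -!mulr_suml.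
rewrite -[leRHS](subrKC w) lerD// ler_piMr ?subr_ge0//.
  by rewrite ler_pdivrMr ?powR_gt0// mul1r.
by rewrite ler_pdivrMr ?powR_gt0// mul1r.
Qed.

Lemma lp_minkowski p n a b : 1 <= p ->
  (forall i, (i < n)%N -> 0 <= a i) -> (forall i, (i < n)%N -> 0 <= b i) ->
  lp p n (fun i => a i + b i) <= lp p n a + lp p n b.
Proof.
move=> p1 a0 b0; apply/ler_addgt0Pr => e e0.
rewrite [e]splitr addrACA; apply: lp_minkowski_gt0 => //.
- by rewrite ltr_wpDl ?lp_ge0 ?divr_gt0.
- by rewrite ltr_wpDl ?lp_ge0 ?divr_gt0.
- by rewrite lerDl ltW// divr_gt0.
- by rewrite lerDl ltW// divr_gt0.
Qed.

Lemma lp_minkowski_sum p n d (a : 'I_d -> nat -> R) : 1 <= p ->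
  (forall j i, 0 <= a j i) ->
  lp p n (fun i => \sum_(j < d) a j i) <= \sum_(j < d) lp p n (a j).
Proof.
move=> p1 a0; elim: d a a0 => [|d IH] a a0.
  rewrite big_ord0; apply/lp_leP => //; rewrite powR0 ?gt_eqF ?(lt_le_trans _ p1)//.
  by rewrite big1// => i _; rewrite big_ord0 powR0// gt_eqF// (lt_le_trans _ p1).
rewrite big_ord_recr/=.
have -> : (fun i => \sum_(j < d.+1) a j i) =
  (fun i => \sum_(j < d) a (widen_ord (leqnSn d) j) i + a ord_max i).
  by apply/funext => i; rewrite big_ord_recr.
apply: (le_trans (lp_minkowski p n _ _ p1 _ _)) => //.
  by move=> i _; apply: sumr_ge0.
by rewrite lerD2r IH.
Qed.

End lp_norm.

(** * Monotone runs: comparing the increments of [f] with those of [g] *)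

Section runs.
Context {R : realType}.
Variables (p e : R) (f g : R -> R).
Hypotheses (p1 : 1 <= p) (e0 : 0 <= e) (fg0 : f 0 = g 0).
Hypothesis touch : forall sg s t : R, sg = 1 \/ sg = -1 -> 0 <= s -> s < t ->
  sg * f s < sg * f t ->
  exists u, [/\ s < u, u <= t & sg * f t <= sg * g u + e].

Let chain (m : nat) (u : nat -> R) :=
  u 0%N = 0 /\ forall i, (i < m)%N -> u i < u i.+1.

(** The slack [2 * e] pays for an error [e] at each of the two ends of an increment. *)
Let cost (m : nat) (u : nat -> R) :=
  \sum_(j < m) (`|g (u j.+1) - g (u j)| + 2 * e) `^ p.

(** The point [v] that [touch] gives in [(a, b]] is appended to the chain. The errors at [u m] and
    at [v] have opposite directions, so the new increment of [g] is at least that of [f] minus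
    [2 * e]. *)
Lemma close_run sg (m : nat) (u : nat -> R) (a b : R) :
  sg = 1 \/ sg = -1 -> chain m u -> u m <= a -> 0 <= a -> a <= b ->
  sg * g (u m) <= sg * f a + e -> 0 < sg * (f b - f a) ->
  exists u', [/\ chain m.+1 u', u' m.+1 <= b,
    sg * f b <= sg * g (u' m.+1) + e &
    cost m u + `|f b - f a| `^ p <= cost m.+1 u'].
Proof.
move=> sgE [u0 ui] uma a0 ab ga fab.
have {}ab : a < b.
  rewrite lt_neqAle ab andbT; apply/eqP => abE.
  by move: fab; rewrite abE subrr mulr0 ltxx.
have [|v [av vb fv]] := touch _ _ _ sgE a0 ab; first by rewrite -subr_gt0 -mulrBr.
pose u' i := if (i <= m)%N then u i else v.
have u'v : u' m.+1 = v by rewrite /u' ltnn.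
have u'u i : (i <= m)%N -> u' i = u i by rewrite /u' => ->.
exists u'; split.
- split=> [|i]; first by rewrite u'u.
  rewrite ltnS leq_eqVlt => /predU1P[->|im]; last by rewrite !u'u// ?ui// ltnW.
  by rewrite u'v u'u// (le_lt_trans uma).
- by rewrite u'v.
- by rewrite u'v.
rewrite /cost big_ord_recr/= u'v u'u// lerD//.
  by rewrite le_eqVlt; apply/orP; left; apply/eqP/eq_bigr => j _; rewrite !u'u// ltnW.
rewrite ge0_ler_powR ?nnegrE ?addr_ge0 ?mulr_ge0 ?(le_trans _ p1)//.
have sgN z : `|z| = `|sg * z| by case: sgE => ->; rewrite ?mul1r// mulN1r normrN.
rewrite [leLHS]sgN (gtr0_norm fab).
have := ler_norm (sg * (g v - g (u m))); rewrite -sgN.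
by rewrite !mulrBr; lra.
Qed.

(* A maximal monotone run of f from a to t n is kept open; a flat run can only
   occur at the start, where its direction may still be chosen. *)
Let open_run (t : nat -> R) (n : nat) := exists m u a sg,
  [/\ (m <= n)%N, chain m u & sg = 1 \/ sg = -1] /\
  [/\ u m <= a, 0 <= a & a <= t n] /\
  [/\ sg * g (u m) <= sg * f a + e, 0 <= sg * (f (t n) - f a),
     0 < sg * (f (t n) - f a) \/ f a = g (u m) &
     \sum_(i < n) `|f (t i.+1) - f (t i)| `^ p <=
       cost m u + `|f (t n) - f a| `^ p].

(** Induction on [n]: a step in the direction [sg] prolongs the run, and a step against it closes
    the run at [t n] and opens one of the opposite sign there. *)
Let open_runP t n : t 0%N = 0 -> (forall i, (i < n)%N -> t i < t i.+1) ->
  open_run t n.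
Proof.
have p0 : 0 < p by exact: lt_le_trans p1.
move=> t0; elim: n => [|n IH] tn.
  exists 0%N, (fun=> 0), 0, 1; rewrite /chain t0 /cost !big_ord0 subrr !mul1r fg0.
  by rewrite normr0 powR0 ?gt_eqF// addr0 lerDl; do !split=> //; [left|right].
have [|m [u [a [sg [[mn cu sgE] [[uma a0 at_] [ga fa fga S]]]]]]] := IH.
  by move=> i /ltnW; exact: tn.
have ttn := tn n (ltnSn n).
have sgN z : `|z| = `|sg * z| by case: sgE => ->; rewrite ?mul1r// mulN1r normrN.
have sgN' : - sg = 1 \/ - sg = -1 by case: sgE => ->; [right|left; rewrite opprK].
have addS (z : R) : \sum_(i < n) `|f (t i.+1) - f (t i)| `^ p +
      `|f (t n.+1) - f (t n)| `^ p <= z ->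
      \sum_(i < n.+1) `|f (t i.+1) - f (t i)| `^ p <= z by rewrite big_ord_recr.
have [up|down] := leP 0 (sg * (f (t n.+1) - f (t n))).
  exists m, u, a, sg; do !split => //; rewrite ?(ltnW mn) ?(leqW mn)//.
  - by rewrite (le_trans at_)// ltW.
  - by move: fa up; rewrite !mulrBr; lra.
  - by case: fga => [fga|]; [left; move: fga up; rewrite !mulrBr; lra|right].
  (* Both increments have the sign [sg], so superadditivity merges them into one. *)
  apply: addS; apply: (le_trans (lerD S (lexx _))); rewrite -addrA lerD2l.
  rewrite 3![`|_ - _|]sgN !ger0_norm//; last by move: fa up; rewrite !mulrBr; lra.
  rewrite (le_trans (powR_superadditive _ _ _ p1 _ _))//.
  by rewrite -mulrDr addrC subrKA.
move: fa; rewrite le_eqVlt => /predU1P[fa|{}fga]; last first.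
  have [u' [cu' u'b gb S']] := close_run _ _ _ _ _ sgE cu uma a0 at_ ga fga.
  have tn0 : 0 <= t n by exact: le_trans at_.
  exists m.+1, u', (t n), (- sg); do !split => //; rewrite ?ltnS//.
  - exact: ltW.
  (* The upper estimate closing the run is, after negation, the estimate required to open one in the
     direction [- sg]. *)
  - by rewrite !mulNr; move: gb; lra.
  - by rewrite mulNr oppr_ge0 ltW.
  - by left; rewrite mulNr oppr_gt0.
  by apply: addS; rewrite lerD2r (le_trans S).
(* The run is flat, so [f a = g (u m)] and the estimate at its start holds for either sign: [sg] is
   flipped with no new chain point. *)
have {}fga : f a = g (u m) by case: fga => //; rewrite -fa ltxx.
have fna : f (t n) = f a.
  by apply/eqP; rewrite -subr_eq0 -normr_eq0 sgN -fa normr0.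
exists m, u, a, (- sg); do !split => //; rewrite ?(leqW mn)//.
- by rewrite (le_trans at_)// ltW.
- by rewrite fga lerDl.
- by rewrite -fna mulNr oppr_ge0 ltW.
- by right.
by apply: addS; rewrite -fna lerD2r (le_trans S)// fna subrr normr0 powR0 ?gt_eqF// addr0.
Qed.

(** The last open run is closed if [f] has moved along it, and dropped if it is flat. The bound on
    [m] later limits the total error made of terms [2 * e]. *)
Lemma sum_increments_chain (t : nat -> R) n :
  t 0%N = 0 -> (forall i, (i < n)%N -> t i < t i.+1) ->
  exists m u, [/\ (m <= n.+1)%N, u 0%N = 0, forall i, (i < m)%N -> u i < u i.+1,
    u m <= t n & \sum_(i < n) `|f (t i.+1) - f (t i)| `^ p <=
     \sum_(j < m) (`|g (u j.+1) - g (u j)| + 2 * e) `^ p].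
Proof.
move=> t0 tn; have p0 : 0 < p by exact: lt_le_trans p1.
have [m [u [a [sg [[mn cu sgE] [[uma a0 at_] [ga fa _ S]]]]]]] := open_runP _ _ t0 tn.
move: fa; rewrite le_eqVlt => /predU1P[fa|fa].
  exists m, u; case: cu => u0 ui; split => //; first exact: leqW.
    exact: le_trans at_.
  have /eqP : sg * (f (t n) - f a) = 0 by [].
  have /negPf sg0 : sg != 0 by case: sgE => ->; rewrite ?oppr_eq0 oner_eq0.
  rewrite mulf_eq0 sg0/= => /eqP fna.
  by move: S; rewrite fna normr0 powR0 ?gt_eqF// addr0.
have [u' [[u0 ui] u'b _ S']] := close_run _ _ _ _ _ sgE cu uma a0 at_ ga fa.
by exists m.+1, u'; split => //; exact: le_trans S'.
Qed.

End runs.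

(** * The Euclidean norm *)

Section eucl_theory.
Context {R : realType} {d : nat}.
Implicit Types u v : 'rV[R]_d.

Lemma eucl_ge0 v : 0 <= eucl v.
Proof. exact: sqrtr_ge0. Qed.

Lemma eucl_le v (C : R) : 0 <= C -> \sum_(i < d) v ord0 i ^+ 2 <= C ^+ 2 -> eucl v <= C.
Proof. by move=> C0 vC; rewrite /eucl -[leRHS](ger0_norm C0) -sqrtr_sqr ler_wsqrtr. Qed.

Lemma sqr_eucl v : eucl v ^+ 2 = \sum_(i < d) v ord0 i ^+ 2.
Proof. by rewrite /eucl sqr_sqrtr// sumr_ge0// => i _; exact: sqr_ge0. Qed.

Lemma norm_coord_le_eucl v i : `|v ord0 i| <= eucl v.
Proof.
rewrite /eucl -sqrtr_sqr ler_wsqrtr// (bigD1 i)//= lerDl sumr_ge0// => j _.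
exact: sqr_ge0.
Qed.

Lemma eucl_le_sum_norm v : eucl v <= \sum_(i < d) `|v ord0 i|.
Proof.
apply: eucl_le; first exact: sumr_ge0.
rewrite [leRHS]expr2 mulr_sumr ler_sum// => i _.
rewrite -real_normK ?num_real// expr2 ler_wpM2r// (bigD1 i)//= lerDl.
exact: sumr_ge0.
Qed.

(** Same scaling as for Minkowski's inequality: [(s+t)^2 <= (A+B) * (s^2/A + t^2/B)], the difference
    being a square over [A * B]. *)
Lemma euclD u v : eucl (u + v) <= eucl u + eucl v.
Proof.
apply/ler_addgt0Pr => e e0; rewrite [e]splitr addrACA.
set A := eucl u + _; set B := eucl v + _.
have A0 : 0 < A by rewrite /A ltr_wpDl ?eucl_ge0 ?divr_gt0.
have B0 : 0 < B by rewrite /B ltr_wpDl ?eucl_ge0 ?divr_gt0.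
apply: eucl_le; first by rewrite addr_ge0 ?ltW.
have uA : \sum_(i < d) u ord0 i ^+ 2 <= A ^+ 2.
  by rewrite -sqr_eucl lerXn2r ?nnegrE ?eucl_ge0 ?(ltW A0)// /A lerDl divr_ge0 ?ltW.
have vB : \sum_(i < d) v ord0 i ^+ 2 <= B ^+ 2.
  by rewrite -sqr_eucl lerXn2r ?nnegrE ?eucl_ge0 ?(ltW B0)// /B lerDl divr_ge0 ?ltW.
have conv i : (u + v) ord0 i ^+ 2 <=
    (A + B) * (u ord0 i ^+ 2 / A + v ord0 i ^+ 2 / B).
  rewrite mxE -subr_ge0; set s := u _ _; set t := v _ _.
  have -> : (A + B) * (s ^+ 2 / A + t ^+ 2 / B) - (s + t) ^+ 2 =
    (s * B - t * A) ^+ 2 / (A * B) by field; rewrite !gt_eqF.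
  by rewrite divr_ge0 ?sqr_ge0// mulr_ge0 ?ltW.
apply: (le_trans (ler_sum _ (fun i _ => conv i))).
rewrite -mulr_sumr big_split/= -!mulr_suml expr2 ler_wpM2l ?(ltW (addr_gt0 A0 B0))//.
by rewrite lerD// ler_pdivrMr// -expr2.
Qed.

End eucl_theory.

(** * The [p]-variation and finite chains of times *)

Section Vp_theory.
Context {R : realType} {d : nat}.
Variables (p : R) (x : R -> 'rV[R]_d) (T : R).
Hypotheses (p1 : 1 <= p) (T0 : 0 <= T).

Let incr (t : nat -> R) (i : nat) : R := eucl (x (t i.+1) - x (t i)).

(** A chain stopping before [T] becomes a subdivision by adding the point [T], which only adds a
    nonnegative term. *)
Lemma sum_le_pvar n (t : nat -> R) :
  t 0%N = 0 -> (forall i, (i < n)%N -> t i < t i.+1) -> t n <= T ->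
  ((\sum_(i < n) incr t i `^ p)%:E <= pvar p x 0 T)%E.
Proof.
move=> t0 tn; rewrite le_eqVlt => /predU1P[tnT|tnT].
  by apply: ereal_sup_ubound; exists n, t.
pose t' i := if (i <= n)%N then t i else T.
have t't i : (i <= n)%N -> t' i = t i by rewrite /t' => ->.
have t'T : t' n.+1 = T by rewrite /t' ltnn.
apply: (@le_trans _ _ (\sum_(i < n.+1) incr t' i `^ p)%:E).
  rewrite lee_fin big_ord_recr/= -[leLHS]addr0.
  apply: lerD; last exact: powR_ge0.
  by apply/ler_sum => i _; rewrite /incr !t't// ltnW.
apply: ereal_sup_ubound; exists n.+1, t'; split => //; split; first by rewrite t't.
split=> // i; rewrite ltnS leq_eqVlt => /predU1P[->|ni]; first by rewrite t'T t't.
by rewrite !t't ?tn// ltnW.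
Qed.

Lemma pvar_ge0 : (0 <= pvar p x 0 T)%E.
Proof. by have := sum_le_pvar 0 (fun=> 0) erefl; rewrite big_ord0; apply. Qed.

Let p0 : 0 <= p^-1.
Proof. by rewrite invr_ge0 (le_trans _ p1). Qed.

Lemma lp_le_Vp n (t : nat -> R) :
  t 0%N = 0 -> (forall i, (i < n)%N -> t i < t i.+1) -> t n <= T ->
  ((lp p n (incr t))%:E <= Vp p x T)%E.
Proof.
move=> t0 tn tnT; rewrite /Vp /lp -poweR_EFin.
apply: (gt0_ler_poweR p0); last exact: sum_le_pvar.
  by rewrite in_itv/= lee_fin sum_powR_ge0 leey.
by rewrite in_itv/= pvar_ge0 leey.
Qed.

Lemma Vp_le (C : R) : 0 <= C ->
  (forall n t, subdivision 0 T n t -> lp p n (incr t) <= C) ->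
  (Vp p x T <= C%:E)%E.
Proof.
move=> C0 lpC.
have -> : C = (C `^ p) `^ p^-1.
  by rewrite -powRrM mulfV ?powRr1// gt_eqF// (lt_le_trans _ p1).
rewrite -poweR_EFin /Vp; apply: (gt0_ler_poweR p0).
- by rewrite in_itv/= pvar_ge0 leey.
- by rewrite in_itv/= lee_fin powR_ge0 leey.
apply: ge_ereal_sup => _ [n [t [st ->]]]; rewrite lee_fin.
by apply/(lp_leP p n (incr t)) => //; exact: lpC.
Qed.

End Vp_theory.

(** * Properties of solutions of the Skorokhod problem *)

Lemma cvg_coord {R : realType} {d : nat} (x : R -> 'rV[R]_d) (i : 'I_d) (t : R) :
  x @ at_right t --> x t -> (fun s => x s ord0 i) @ at_right t --> x t ord0 i.
Proof.
move=> xt; apply: (@continuous_cvg _ _ _ _ _ x (fun M : 'rV[R]_d => M ord0 i)) => //.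
exact: coord_continuous.
Qed.

Section SP_theory.
Context {R : realType} {d : nat}.
Variables l y x k : R -> 'rV[R]_d.
Hypotheses (cl : cadlag l) (sp : SP l y x k).

(** Contact is taken for [h = x - l] in coordinate [j]: a zero of [h] is a time at which
    [k = l - y]. *)
Lemma SP_touch (j : 'I_d) (s t e : R) : 0 <= s -> s < t ->
  k s ord0 j < k t ord0 j -> 0 < e ->
  exists u, [/\ s < u, u <= t, k u ord0 j = l u ord0 j - y u ord0 j &
    k t ord0 j - e <= k u ord0 j].
Proof.
case: sp => -[cx _] [_] [xyk] [_] [_] /(_ j)[F [Fk [_ iF]]] s0 st kst e0.
have t0 : 0 <= t by rewrite (le_trans s0)// ltW.
pose h u := x u ord0 j - l u ord0 j.
have hr u : 0 <= u -> h @ at_right u --> h u.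
  by move=> u0; apply: cvgB; apply: cvg_coord; [exact: cx|exact: cl.1].
have h0 u : 0 <= u -> 0 <= h u by move=> /xyk[_ lx]; rewrite subr_ge0.
have [|u [su ut hu Fu]] :=
  stieltjes_integral0_touch F h s t e s0 (ltW st) hr h0 (iF t t0) _ e0.
  by rewrite !Fk.
have u0 : 0 <= u by rewrite (le_trans s0)// ltW.
exists u; split => //; last by rewrite -!Fk.
by move: hu; rewrite /h (xyk u u0).1 mxE; lra.
Qed.

Lemma SP_barrier (j : 'I_d) (t : R) : 0 <= t ->
  l t ord0 j - y t ord0 j <= k t ord0 j.
Proof.
case: sp => _ [_] [xyk] _ /xyk [-> /(_ j)].
by rewrite mxE lerBlDl.
Qed.

Lemma SP_nondecreasing (j : 'I_d) (s t : R) : 0 <= s -> s <= t ->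
  k s ord0 j <= k t ord0 j.
Proof. by case: sp => _ [_] [_] [_] [nd _]; exact: nd. Qed.

End SP_theory.

(** * Bounds for [k - k'] and [x - x'] when the data have finite variation *)

Section component_bound.
Context {R : realType} {d : nat}.
Variables (p T A B : R) (l y x k l' y' x' k' : R -> 'rV[R]_d).
Hypotheses (p1 : 1 <= p) (cl : cadlag l) (cl' : cadlag l').
Hypotheses (sp : SP l y x k) (sp' : SP l' y' x' k') (T0 : 0 <= T).
Hypothesis VyA : (Vp p (fun t => y t - y' t)%R T <= A%:E)%E.
Hypothesis VlB : (Vp p (fun t => l t - l' t)%R T <= B%:E)%E.

Let Y t := y t - y' t.
Let L t := l t - l' t.
Let c := eucl (Y 0) + eucl (L 0).

(* The value at 0 is reset to k 0 - k' 0 = 0; this is where |Y 0| + |L 0| comes from. *)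
Let gap (j : 'I_d) (t : R) := if t == 0 then 0 else L t ord0 j - Y t ord0 j.

(** Only the first increment starts at time [0], where [gap] differs from [L - Y] by at most [c];
    all later chain points are positive. *)
Let gap_incr j (u : nat -> R) m i : u 0%N = 0 ->
  (forall i, (i < m)%N -> u i < u i.+1) -> (i < m)%N ->
  `|gap j (u i.+1) - gap j (u i)| <=
    eucl (Y (u i.+1) - Y (u i)) + eucl (L (u i.+1) - L (u i)) +
    (if i == 0%N then c else 0).
Proof.
move=> u0 ui im.
have upos i' : (i' < m)%N -> 0 < u i'.+1.
  elim: i' => [|i' IH] i'm; first by rewrite -u0 ui.
  by rewrite (lt_trans (IH _) (ui _ i'm))// ltnW.
have := norm_coord_le_eucl (Y (u i.+1) - Y (u i)) j.
have := norm_coord_le_eucl (L (u i.+1) - L (u i)) j.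
rewrite {1}/gap gt_eqF ?upos// !mxE.
case: i im => [|i] im /=.
  rewrite u0 /gap eqxx /c.
  have := norm_coord_le_eucl (Y 0) j; have := norm_coord_le_eucl (L 0) j.
  rewrite !ler_norml !mxE; lra.
rewrite /gap gt_eqF ?upos 1?ltnW// addr0 !ler_norml !mxE; lra.
Qed.

(** If [sg = 1], [k] must increase since [k'] does not decrease, so contact is sought for the first
    problem; if [sg = -1] the two problems exchange roles. As [u > s >= 0], the reset of [gap] at
    [0] does not interfere. *)
Let touch j e : 0 < e -> forall sg s t : R, sg = 1 \/ sg = -1 -> 0 <= s -> s < t ->
  sg * (k s - k' s) ord0 j < sg * (k t - k' t) ord0 j ->
  exists u, [/\ s < u, u <= t & sg * (k t - k' t) ord0 j <= sg * gap j u + e].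
Proof.
move=> e0 sg s t sgE s0 st; rewrite !mxE => kst.
have kk := SP_nondecreasing _ _ _ _ sp j _ _ s0 (ltW st).
have kk' := SP_nondecreasing _ _ _ _ sp' j _ _ s0 (ltW st).
have gapE u : s < u -> gap j u =
   l u ord0 j - y u ord0 j - (l' u ord0 j - y' u ord0 j).
  by move=> su; rewrite /gap gt_eqF ?(le_lt_trans s0)// !mxE; lra.
case: sgE kst => ->; rewrite ?mulN1r ?mul1r => kst.
  have [|u [su ut ku ktu]] := SP_touch _ _ _ _ cl sp j _ _ _ s0 st _ e0; first by lra.
  have u0 : 0 <= u by rewrite (le_trans s0)// ltW.
  exists u; split=> //; rewrite gapE// !mul1r.
  have := SP_nondecreasing _ _ _ _ sp' j _ _ u0 ut; have := SP_barrier _ _ _ _ sp' j _ u0; lra.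
have [|u [su ut ku ktu]] := SP_touch _ _ _ _ cl' sp' j _ _ _ s0 st _ e0; first by lra.
have u0 : 0 <= u by rewrite (le_trans s0)// ltW.
exists u; split=> //; rewrite gapE// !mulN1r.
have := SP_nondecreasing _ _ _ _ sp j _ _ u0 ut; have := SP_barrier _ _ _ _ sp j _ u0; lra.
Qed.

Lemma lp_component_le (j : 'I_d) n (t : nat -> R) : subdivision 0 T n t ->
  lp p n (fun i => `|(k (t i.+1) - k' (t i.+1)) ord0 j - (k (t i) - k' (t i)) ord0 j|)
  <= A + B + c.
Proof.
move=> [t0 [tT tn]]; apply/ler_addgt0Pr => e' e'0.
(* The chain has at most [n + 1] increments, each with error [2 * e], so the errors add up to at
   most [e']. *)
pose e := e' / (2 * n.+1%:R).
have e0 : 0 < e by rewrite divr_gt0// mulr_gt0.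
have fg0 : (k 0 - k' 0) ord0 j = gap j 0.
  rewrite /gap eqxx; case: sp => _ [_] [_] [-> _]; case: sp' => _ [_] [_] [-> _].
  by rewrite subrr mxE.
have [m [u [mn u0 ui umT S]]] := sum_increments_chain p e
  (fun t => (k t - k' t) ord0 j) (gap j) p1 (ltW e0) fg0 (touch j e e0) t n t0 tn.
rewrite tT in umT.
have c0 : 0 <= c by rewrite addr_ge0 ?eucl_ge0.
pose a i := eucl (Y (u i.+1) - Y (u i)).
pose b i := eucl (L (u i.+1) - L (u i)).
pose z i : R := if i == 0%N then c else 0.
have z0 i : 0 <= z i by rewrite /z; case: ifP.
have a0 i : 0 <= a i := eucl_ge0 _.
have b0 i : 0 <= b i := eucl_ge0 _.
have e20 : 0 <= 2 * e by rewrite mulr_ge0// ltW.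
apply: (@le_trans _ _ (lp p m (fun i => a i + b i + z i + 2 * e))).
  apply/lp_leP; rewrite ?lp_ge0//; apply: (le_trans S); rewrite lp_powR//.
  apply: ler_sum => i _; rewrite ge0_ler_powR ?nnegrE ?(le_trans _ p1)//.
  - by rewrite addr_ge0.
  - by rewrite !addr_ge0.
  - by rewrite lerD2r; exact: (gap_incr j u m).
apply: (le_trans (lp_minkowski p m (fun i => a i + b i + z i) (fun=> 2 * e) p1 _ _)) => //.
  by move=> i _; rewrite !addr_ge0.
apply: lerD; last first.
  apply: (le_trans (lp_le_sum p m (fun=> 2 * e) p1 _)) => //.
  rewrite sumr_const card_ord -(mulr_natr (2 * e)).
  have -> : e' = 2 * e * n.+1%:R by rewrite mulrAC mulrC divfK// mulf_neq0.
  by rewrite ler_wpM2l// ler_nat.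
apply: (le_trans (lp_minkowski p m (fun i => a i + b i) z p1 _ _)) => //.
  by move=> i _; rewrite !addr_ge0.
(* [z] has at most one nonzero entry, so [c] is counted once. *)
apply: lerD; last first.
  apply: (le_trans (lp_le_sum p m z p1 _)) => //.
  case: (m) => [|m']; first by rewrite big_ord0.
  by rewrite big_ord_recl/= big1 ?addr0.
apply: (le_trans (lp_minkowski p m a b p1 _ _)) => //.
apply: lerD; rewrite -lee_fin.
  by apply: le_trans VyA; exact: lp_le_Vp.
by apply: le_trans VlB; exact: lp_le_Vp.
Qed.

(** The factor [d] comes from bounding the Euclidean norm by the sum of the absolute values of the
    coordinates. *)
Lemma lp_k_le n (t : nat -> R) : subdivision 0 T n t ->
  lp p n (fun i => eucl ((k (t i.+1) - k' (t i.+1)) - (k (t i) - k' (t i))))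
  <= d%:R * (A + B + c).
Proof.
move=> st; pose D (j : 'I_d) i :=
  `|(k (t i.+1) - k' (t i.+1)) ord0 j - (k (t i) - k' (t i)) ord0 j|.
apply: (@le_trans _ _ (lp p n (fun i => \sum_(j < d) D j i))).
  apply: le_lp => // i _; rewrite eucl_ge0 (le_trans (eucl_le_sum_norm _))//.
  by apply: ler_sum => j _; rewrite /D !mxE.
apply: (le_trans (lp_minkowski_sum p n d D p1 _)); first by move=> *; exact: normr_ge0.
rewrite mulr_natl -[X in _ *+ X]card_ord -sumr_const.
by apply: ler_sum => j _; exact: lp_component_le.
Qed.

Lemma Vp_k_le : 0 <= A -> 0 <= B ->
  (Vp p (fun t => k t - k' t)%R T <= (d%:R * (A + B + c))%:E)%E.
Proof.
move=> A0 B0; apply: Vp_le => //; last exact: lp_k_le.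
by rewrite mulr_ge0// !addr_ge0// eucl_ge0.
Qed.

(** Minkowski's inequality for [x - x' = (y - y') + (k - k')]; the extra [A] turns the coefficient
    [d] into [d + 1]. *)
Lemma Vp_x_le : 0 <= A -> 0 <= B ->
  (Vp p (fun t => x t - x' t)%R T <= (A + d%:R * (A + B + c))%:E)%E.
Proof.
move=> A0 B0; apply: Vp_le => //.
  by rewrite addr_ge0// mulr_ge0// !addr_ge0// eucl_ge0.
move=> n t st; have [t0 [tT tn]] := st.
pose a i := eucl (Y (t i.+1) - Y (t i)).
pose b i := eucl ((k (t i.+1) - k' (t i.+1)) - (k (t i) - k' (t i))).
have tge0 i : (i <= n)%N -> 0 <= t i.
  elim: i => [|i IH] i_n; first by rewrite t0.
  by rewrite (le_trans (IH (ltnW i_n)))// ltW// tn.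
have xE s : 0 <= s -> x s - x' s = Y s + (k s - k' s).
  move=> s0; case: sp => _ [_] [/(_ s s0)[-> _] _].
  by case: sp' => _ [_] [/(_ s s0)[-> _] _]; rewrite opprD addrACA.
apply: (@le_trans _ _ (lp p n (fun i => a i + b i))).
  apply: le_lp => // i i_n; rewrite eucl_ge0/= !xE ?tge0// 1?ltnW//.
  by rewrite opprD addrACA euclD.
apply: (le_trans (lp_minkowski p n a b p1 _ _)).
- by move=> i _; exact: eucl_ge0.
- by move=> i _; exact: eucl_ge0.
apply: lerD; last exact: lp_k_le.
by rewrite -lee_fin; apply: le_trans VyA; apply: lp_le_Vp => //; rewrite tT.
Qed.

End component_bound.

(** * Dimension zero, infinite variation and the final bounds *)

Lemma Vp_dim0 {R : realType} {d : nat} (p T : R) (x : R -> 'rV[R]_d) :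
  d = 0%N -> 1 <= p -> 0 <= T -> (Vp p x T <= 0)%E.
Proof.
move=> d0 p1 T0; case: _ / (esym d0) in x *; apply: Vp_le => // n t _; apply/lp_leP => //.
have p0 : p != 0 by rewrite gt_eqF// (lt_le_trans _ p1).
by rewrite powR0// big1// => i _; rewrite /eucl big_ord0 sqrtr0 powR0.
Qed.

Theorem theorem2 (R : realType) (d : nat) (p : R)
    (l y l' y' x k x' k' : R -> 'rV[R]_d) :
  1 <= p ->
  cadlag l -> cadlag y -> cadlag l' -> cadlag y' ->
  vle (l 0) (y 0) -> vle (l' 0) (y' 0) ->
  SP l y x k -> SP l' y' x' k' ->
  forall T : R, 0 <= T ->
  (Vp p (fun t => x t - x' t)%R T <=
     (d.+1%:R)%:E * Vp p (fun t => y t - y' t)%R T + (d%:R * eucl (y 0 - y' 0))%:E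
     + d%:R%:E * Vp p (fun t => l t - l' t)%R T + (d%:R * eucl (l 0 - l' 0))%:E)%E /\
  (Vp p (fun t => k t - k' t)%R T <=
     d%:R%:E * Vp p (fun t => y t - y' t)%R T + (d%:R * eucl (y 0 - y' 0))%:E
     + d%:R%:E * Vp p (fun t => l t - l' t)%R T + (d%:R * eucl (l 0 - l' 0))%:E)%E.
Proof.
move=> p1 cl _ cl' _ _ _ sp sp' T T0.
have c1 : 0 <= eucl (y 0 - y' 0) := eucl_ge0 _.
have c2 : 0 <= eucl (l 0 - l' 0) := eucl_ge0 _.
set a := Vp p (fun t => y t - y' t) T; set b := Vp p (fun t => l t - l' t) T.
have a0 : (0 <= a)%E := poweR_ge0 _ _.
have b0 : (0 <= b)%E := poweR_ge0 _ _.
have rhs_ge0 m : (0 <= m%:R%:E * a + (d%:R * eucl (y 0 - y' 0))%:E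
    + d%:R%:E * b + (d%:R * eucl (l 0 - l' 0))%:E)%E.
  have dc1 : (0 <= (d%:R * eucl (y 0 - y' 0))%:E)%E by rewrite lee_fin mulr_ge0.
  have dc2 : (0 <= (d%:R * eucl (l 0 - l' 0))%:E)%E by rewrite lee_fin mulr_ge0.
  apply: adde_ge0 dc2; apply: adde_ge0; first apply: adde_ge0 dc1.
    by apply: mule_ge0 a0; rewrite lee_fin.
  by apply: mule_ge0 b0; rewrite lee_fin.
(* Dimension [0] is treated apart: there [0 * +oo = 0], so an infinite variation need not make the
   right-hand side infinite. *)
have [d0|dpos] := posnP d.
  by split; apply: le_trans (rhs_ge0 _); exact: Vp_dim0.
have dS0 : 0 < d.+1%:R :> R by rewrite ltr0n.
have d0 : 0 < d%:R :> R by rewrite ltr0n.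
(* For [d > 0], an infinite variation of [y - y'] or of [l - l'] makes the right-hand sides
   [+oo]. *)
have addy1 (m r s : R) (z : \bar R) : 0 < m -> z != -oo%E ->
    (m%:E * +oo + r%:E + z + s%:E = +oo)%E.
  by move=> m0 zN; rewrite gt0_muley ?lte_fin//; case: z zN.
have addy2 (m q r s : R) : 0 < m -> (q%:E + r%:E + m%:E * +oo + s%:E = +oo)%E.
  by move=> m0; rewrite gt0_muley ?lte_fin.
case aE : a a0 => [A| |]// A0; last first.
  have db : (d%:R%:E * b)%E != -oo%E.
    by rewrite gt_eqF// (lt_le_trans ltNy0)// mule_ge0// lee_fin.
  split; first by rewrite (addy1 _ _ _ _ dS0 db) leey.
  by rewrite (addy1 _ _ _ _ d0 db) leey.
case bE : b b0 => [B| |]// B0; last first.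
  by split; rewrite -EFinM (addy2 _ _ _ _ d0) leey.
rewrite !lee_fin in A0 B0.
have aA : (a <= A%:E)%E by rewrite aE.
have bB : (b <= B%:E)%E by rewrite bE.
split; rewrite -!EFinM -!EFinD.
  rewrite (le_trans (Vp_x_le _ _ _ _ _ _ _ _ _ _ _ _ p1 cl cl' sp sp' T0 aA bB A0 B0))//.
  by rewrite lee_fin -natr1 le_eqVlt; apply/orP; left; apply/eqP; ring.
rewrite (le_trans (Vp_k_le _ _ _ _ _ _ _ _ _ _ _ _ p1 cl cl' sp sp' T0 aA bB A0 B0))//.
by rewrite lee_fin le_eqVlt; apply/orP; left; apply/eqP; ring.
Qed.
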